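(* For every integer $n\ge0$, let $\mathcal T_n^{\mathrm B}$ denote a butterfly tree with $N=2^n$ nodes. Then $$\operatorname{supp}(\operatorname{HS}(\mathcal T_n^{\mathrm B}))=\{0,1,\ldots,\lfloor n/2\rfloor\},$$ that is, the set of values attained by $\operatorname{HS}$ over all butterfly trees with $2^n$ nodes is exactly $\{0,1,\ldots,\lfloor n/2\rfloor\}$.
   Context: A rooted binary tree is a finite nonempty rooted tree in which each node has at most one left child and at most one right child. The Horton--Strahler (HS) number of a node $v$ is: $0$ if $v$ has no children; the HS number of the child if $v$ has exactly one child; and $\max(\operatorname{HS}(v_\ell),\operatorname{HS}(v_r))+\mathbf 1_{\{\operatorname{HS}(v_\ell)=\operatorname{HS}(v_r)\}}$ if $v$ has children $v_\ell,v_r$. $\operatorname{HS}(\mathcal T)$ is the HS number of the root of $\mathcal T$. $\mathcal T_1\oplus\mathcal T_2$ is obtained by making the root of $\mathcal T_2$ the right child of the last node of the path from the root of $\mathcal T_1$ that always moves to the right child; $\mathcal T_1\ominus\mathcal T_2$ is obtained by making the root of $\mathcal T_2$ the left child of the last node of the path from the root of $\mathcal T_1$ that always moves to the left child. Butterfly trees: the only butterfly tree with $2^0$ nodes is the single-node tree; the butterfly trees with $2^{n+1}$ nodes are exactly the trees $\mathcal T\oplus\widetilde{\mathcal T}$ and $\mathcal T\ominus\widetilde{\mathcal T}$, where $\mathcal T,\widetilde{\mathcal T}$ are (not necessarily equal) butterfly trees with $2^n$ nodes. *)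

(* Defs.v *)
From mathcomp Require Import all_boot.

Set Implicit Arguments.
Unset Strict Implicit.
Unset Printing Implicit Defensive.

(* Rooted binary trees, which are nonempty: each node has at most one left and
   at most one right child, and a lone child is either a left or a right one. *)
Inductive bintree : Type :=
  | Single
  | LeftOnly of bintree
  | RightOnly of bintree
  | Both of bintree & bintree.

Fixpoint num_nodes (t : bintree) : nat :=
  match t with
  | Single => 1
  | LeftOnly l => (num_nodes l).+1
  | RightOnly r => (num_nodes r).+1
  | Both l r => (num_nodes l + num_nodes r).+1
  end.

(* The Horton--Strahler number of the root. *)
Fixpoint HS (t : bintree) : nat :=
  match t with
  | Single => 0
  | LeftOnly l => HS l
  | RightOnly r => HS r
  | Both l r => maxn (HS l) (HS r) + (HS l == HS r)
  end.

(* [oplus t1 t2] makes the root of [t2] the right child of the last node of the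
   path from the root of [t1] that always moves to the right child. *)
Fixpoint oplus (t1 t2 : bintree) : bintree :=
  match t1 with
  | Single => RightOnly t2
  | LeftOnly l => Both l t2
  | RightOnly r => RightOnly (oplus r t2)
  | Both l r => Both l (oplus r t2)
  end.

(* The mirror image of [oplus], along the path of left children. *)
Fixpoint ominus (t1 t2 : bintree) : bintree :=
  match t1 with
  | Single => LeftOnly t2
  | LeftOnly l => LeftOnly (ominus l t2)
  | RightOnly r => Both t2 r
  | Both l r => Both (ominus l t2) r
  end.

(* [butterfly n t]: [t] is a butterfly tree with [2 ^ n] nodes; that the index
   determines the number of nodes is [num_nodes_butterfly] below. *)
Inductive butterfly : nat -> bintree -> Prop :=
  | butterfly0 : butterfly 0 Single
  | butterfly_oplus n t1 t2 :
      butterfly n t1 -> butterfly n t2 -> butterfly n.+1 (oplus t1 t2)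
  | butterfly_ominus n t1 t2 :
      butterfly n t1 -> butterfly n t2 -> butterfly n.+1 (ominus t1 t2).

Lemma num_nodes_oplus t1 t2 :
  num_nodes (oplus t1 t2) = num_nodes t1 + num_nodes t2.
Proof.
by elim: t1 => [|l _|r IH|l _ r IH] //=; rewrite ?IH ?addSn ?addnA.
Qed.

Lemma num_nodes_ominus t1 t2 :
  num_nodes (ominus t1 t2) = num_nodes t1 + num_nodes t2.
Proof.
elim: t1 => [|l IH|r _|l IH r _] //=; rewrite ?IH ?addSn //.
  by rewrite addnC.
by rewrite addnAC.
Qed.

Lemma num_nodes_butterfly n t : butterfly n t -> num_nodes t = 2 ^ n.
Proof.
elim=> [|{}n t1 t2 _ IH1 _ IH2|{}n t1 t2 _ IH1 _ IH2] //.
  by rewrite num_nodes_oplus IH1 IH2 expnS mul2n addnn.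
by rewrite num_nodes_ominus IH1 IH2 expnS mul2n addnn.
Qed.

(* Main.v *)
Require Import Defs.
From mathcomp Require Import all_boot zify.

Set Implicit Arguments.
Unset Strict Implicit.
Unset Printing Implicit Defensive.

(** Shift HS numbers by one, an empty subtree having value 0: then every node
    combines the values of its two children by [hsop]. Grafting at the two
    spines of [t] acts through two functions, [lside t] and [rside t], and
    [oplus], [ominus] compose these. For a butterfly tree with [2 ^ n] nodes the
    two subtrees of the root have shifted values at most [ceil (n / 2)] with sum
    at most [n], and both functions preserve every upper bound above [n / 2];
    hence the shifted value of the tree is at most [n / 2 + 1]. Conversely, two long chains that both end
    in a tree of HS number [k] with [2 ^ n] nodes combine to a tree of HS number
    [k + 1] with [2 ^ (n + 2)] nodes. *)

Definition hsop (a b : nat) : nat := maxn a b + (a == b).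

Lemma hsopC a b : hsop a b = hsop b a.
Proof. by rewrite /hsop maxnC eq_sym. Qed.

(* The shifted HS number of [t] after grafting trees of shifted HS numbers [x]
   and [y] at the ends of its left and right spines. *)
Fixpoint graftHS (t : bintree) (x y : nat) : nat :=
  match t with
  | Single => hsop x y
  | LeftOnly l => hsop (graftHS l x 0) y
  | RightOnly r => hsop x (graftHS r 0 y)
  | Both l r => hsop (graftHS l x 0) (graftHS r 0 y)
  end.

(** The value in the left child slot of the root; an empty slot receives the graft itself. *)
Definition lside (t : bintree) (x : nat) : nat :=
  match t with LeftOnly l | Both l _ => graftHS l x 0 | _ => x end.

Definition rside (t : bintree) (y : nat) : nat :=
  match t with RightOnly r | Both _ r => graftHS r 0 y | _ => y end.

Lemma graftHSE t x y : graftHS t x y = hsop (lside t x) (rside t y).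
Proof. by case: t. Qed.

Lemma graftHS00 t : graftHS t 0 0 = (HS t).+1.
Proof.
elim: t => [|l IHl|r IHr|l IHl r IHr] //=; rewrite ?IHl ?IHr /hsop.
- by rewrite maxn0 addn0.
- by rewrite max0n addn0.
- by rewrite maxnSS eqSS addSn.
Qed.

Lemma lside_oplus t1 t2 x : lside (oplus t1 t2) x = lside t1 x.
Proof. by case: t1. Qed.

Lemma rside_ominus t1 t2 y : rside (ominus t1 t2) y = rside t1 y.
Proof. by case: t1. Qed.

Lemma graftHS_oplus t1 t2 x y :
  graftHS (oplus t1 t2) x y = graftHS t1 x (graftHS t2 0 y).
Proof. by elim: t1 x => [|l _|r IH|l _ r IH] x //=; rewrite IH. Qed.

Lemma graftHS_ominus t1 t2 x y :
  graftHS (ominus t1 t2) x y = graftHS t1 (graftHS t2 x 0) y.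
Proof. by elim: t1 y => [|l IH|r _|l IH r _] y //=; rewrite IH. Qed.

Lemma rside_oplus t1 t2 y :
  rside (oplus t1 t2) y = rside t1 (hsop (lside t2 0) (rside t2 y)).
Proof. by rewrite -graftHSE; case: t1 => *; rewrite /= ?graftHS_oplus. Qed.

Lemma lside_ominus t1 t2 x :
  lside (ominus t1 t2) x = lside t1 (hsop (rside t2 0) (lside t2 x)).
Proof.
by rewrite hsopC -graftHSE; case: t1 => *; rewrite /= ?graftHS_ominus.
Qed.

Definition side_bound (n : nat) (f g : nat -> nat) : Prop :=
  [/\ f 0 <= uphalf n, g 0 <= uphalf n, f 0 + g 0 <= n,
      forall K y, n./2 < K -> y <= K -> f y <= K &
      forall K y, n./2 < K -> y <= K -> g y <= K].

Lemma side_boundC n f g : side_bound n f g -> side_bound n g f.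
Proof. by case=> f0 g0 fg0 fK gK; split=> //; rewrite addnC. Qed.

(** If the values tie, each is at most [n./2] because their sum is at most [n]; otherwise the
    maximum is at most [uphalf n]. *)
Lemma hsop_le n f g : side_bound n f g -> hsop (g 0) (f 0) <= n./2.+1.
Proof. by case=> f0 g0 fg0 _ _; rewrite /hsop; case: eqP => /=; lia. Qed.

Lemma side_bound_comp n f1 g1 f2 g2 f g :
    (forall y, f y = f1 (hsop (g2 0) (f2 y))) -> g =1 g1 ->
  side_bound n f1 g1 -> side_bound n f2 g2 -> side_bound n.+1 f g.
Proof.
move=> fE gE [f10 g10 fg10 f1K g1K] b2.
have f0 : f 0 <= n./2.+1 by rewrite fE; exact: f1K _ _ (ltnSn _) (hsop_le b2).
case: b2 => _ g20 _ f2K _; split; rewrite ?gE.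
- by lia.
- by lia.
- by lia.
(* Here [K] exceeds [uphalf n], so [g2 0 < K] and a tie in [hsop] still gives at most [K]. *)
- move=> K y nK yK; have nK' : n./2 < K by lia.
  rewrite fE; apply: f1K => //; have := f2K K y nK' yK.
  by rewrite /hsop; case: eqP => /=; lia.
- by move=> K y nK yK; rewrite gE; apply: g1K => //; lia.
Qed.

Lemma butterfly_side_bound n t :
  butterfly n t -> side_bound n (rside t) (lside t).
Proof.
elim=> [|{}n t1 t2 _ b1 _ b2|{}n t1 t2 _ b1 _ b2]; first by split.
- exact: side_bound_comp (rside_oplus t1 t2) (lside_oplus t1 t2) b1 b2.
- apply: side_boundC.
  exact: side_bound_comp (lside_ominus t1 t2) (rside_ominus t1 t2)
    (side_boundC b1) (side_boundC b2).
Qed.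

Lemma butterfly_HS_le n t : butterfly n t -> HS t <= n./2.
Proof.
by move=> /butterfly_side_bound /hsop_le; rewrite -graftHSE graftHS00.
Qed.

Lemma ominus_chain m t :
  ominus (iter m LeftOnly Single) t = iter m.+1 LeftOnly t.
Proof. by elim: m => //= m ->. Qed.

Lemma oplus_chain m t :
  oplus (iter m RightOnly Single) t = iter m.+1 RightOnly t.
Proof. by elim: m => //= m ->. Qed.

Lemma butterfly_left_chain n : exists m, butterfly n (iter m LeftOnly Single).
Proof.
elim: n => [|n [m bm]]; first by exists 0; constructor.
exists (m.+1 + m); rewrite iterD -ominus_chain.
exact: butterfly_ominus.
Qed.

Lemma butterfly_right_chain n :
  exists m, butterfly n (iter m RightOnly Single).
Proof.
elim: n => [|n [m bm]]; first by exists 0; constructor.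
exists (m.+1 + m); rewrite iterD -oplus_chain.
exact: butterfly_oplus.
Qed.

Lemma HS_left_chain m t : HS (iter m LeftOnly t) = HS t.
Proof. by elim: m. Qed.

Lemma HS_right_chain m t : HS (iter m RightOnly t) = HS t.
Proof. by elim: m. Qed.

Lemma butterfly_HS_attained k n :
  k.*2 <= n -> exists t, butterfly n t /\ HS t = k.
Proof.
elim: k n => [|k IHk] n.
  have [m bm] := butterfly_left_chain n.
  by exists (iter m LeftOnly Single); rewrite HS_left_chain.
case: n => [|[|n]] //; rewrite doubleS !ltnS => /IHk[t [bt HSt]].
have [l bl] := butterfly_left_chain n.
have [r br] := butterfly_right_chain n.
(* The left chain has no right child at its root, so [oplus] acts there: both subtrees of the root
   are chains ending in [t], and they tie. *)
exists (oplus (ominus (iter l LeftOnly Single) t)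
              (oplus (iter r RightOnly Single) t)); split.
  by apply: butterfly_oplus; [exact: butterfly_ominus|exact: butterfly_oplus].
rewrite ominus_chain oplus_chain /= HS_left_chain HS_right_chain HSt.
by rewrite maxnn eqxx addn1.
Qed.

Theorem proposition4 (n : nat) :
  forall k : nat, (exists t : bintree, butterfly n t /\ HS t = k) <-> k <= n %/ 2.
Proof.
move=> k; rewrite divn2; split=> [[t [bt <-]]|kn].
  exact: butterfly_HS_le.
by apply: butterfly_HS_attained; lia.
Qed.
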